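(* Let $S=e_{12}+e_{23}\in M_3(\mathbb{C})$ and let $$\psi(x,z)=e^{xz}\left(Iz-Ix^{-1}+Sx^{-2}-S^2x^{-3}\right).$$ Let $\mathbb{A}$ be the set of all $\theta\in M_3(\mathbb{C})[x]$ for which there exists a matrix differential operator $B=B(z,\partial_z)$ with $(\psi B)(x,z)=\theta(x)\psi(x,z)$. Let $\Gamma$ be the set of all matrix polynomials of the form $$\begin{pmatrix} r_0^{11} & r_0^{12} & r_0^{13}\\ 0 & r_0^{22} & r_0^{23}\\ 0&0&r_0^{11}\end{pmatrix}+\begin{pmatrix} r_1^{11} & r_1^{12} & r_1^{13}\\ r_0^{22}-r_0^{11} & r_1^{22} & r_1^{23}\\ 0 & r_0^{22}-r_0^{11} & r_1^{11}+r_0^{23}-r_0^{12}\end{pmatrix}x$$ $$+\begin{pmatrix} r_2^{11} & r_2^{12} & r_2^{13}\\ r_1^{22}-r_1^{11}-r_0^{23}+r_0^{12} & r_2^{22} & r_2^{23}\\ r_0^{22}-r_0^{11} & r_1^{22}-r_1^{11} & r_2^{11}+r_1^{23}-r_1^{12}\end{pmatrix}x^2+\begin{pmatrix} r_3^{11} & r_3^{12} & r_3^{13}\\ r_3^{21} & r_3^{22} & r_3^{23}\\ r_1^{22}-2r_1^{11}-r_0^{23}+r_0^{12} & r_3^{32} & r_3^{33}\end{pmatrix}x^3$$ $$+\begin{pmatrix} r_4^{11} & r_4^{12} & r_4^{13}\\ r_4^{21} & r_4^{22} & r_4^{23}\\ r_3^{32}+r_3^{21}-r_2^{22}-r_2^{11}+r_1^{12}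 & r_4^{32} & r_4^{33}\end{pmatrix}x^4$$ $$+\begin{pmatrix} r_5^{11} & r_5^{12} & r_5^{13}\\ r_5^{21} & r_5^{22} & r_5^{23}\\ r_4^{32}+r_4^{21}-r_3^{33}-r_3^{22}-r_3^{11}+r_2^{23}+r_2^{12}-r_1^{13} & r_5^{32} & r_5^{33}\end{pmatrix}x^5+x^6p(x),$$ where $p\in M_3(\mathbb{C})[x]$ and all the variables $r_k^{ij}\in\mathbb{C}$ appearing are arbitrary. Then $\Gamma=\mathbb{A}$. Furthermore, $\mathbb{A}$ has the presentation $\mathbb{A}\cong\mathbb{C}\langle\alpha_2,\alpha_3\rangle/I$, where $I$ is the two-sided ideal $$I=\langle\alpha_2^3,\ \alpha_3^2-\alpha_3,\ (\alpha_3\alpha_2)^2\alpha_3-4\alpha_3\alpha_2^2\alpha_3\rangle.$$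
   Context: $e_{r,s}$ denotes the matrix with $1$ in entry $(r,s)$ and zeros elsewhere, and $I$ (in $\psi$) is the identity matrix. A matrix differential operator $B=B(z,\partial_z)$ acts on $\psi$ from the right: $(\psi B)(x,z)=\sum_{j=0}^m \partial_z^j\psi(x,z)\cdot b_j(z)$, with $b_j$ matrix-valued functions of $z$. $\mathbb{C}\langle\alpha_2,\alpha_3\rangle$ denotes the free (noncommutative) associative $\mathbb{C}$-algebra on $\alpha_2,\alpha_3$, and a presentation means an algebra isomorphism $\mathbb{C}\langle\alpha_2,\alpha_3\rangle/I\to\mathbb{A}$. *)

(* Defs.v *)
From HB Require Import structures.
From mathcomp Require Import all_boot all_order all_algebra.
From mathcomp Require Import all_classical all_reals all_analysis.
From mathcomp Require Import complex.
Set Implicit Arguments. Unset Strict Implicit. Unset Printing Implicit Defensive.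
Import Order.TTheory GRing.Theory Num.Theory.
Import numFieldNormedType.Exports.
Local Open Scope ring_scope.
Local Open Scope complex_scope.

Section Defs.
Variable R : realType.
Local Notation C := (R[i]).

Definition cexp (w : C) : C :=
  let: a +i* b := w in (expR a * cos b) +i* (expR a * sin b).

Definition Smx : 'M[C]_3 := delta_mx 0 1 + delta_mx 1 2.

(* psi(x,z) = e^{xz} (I z - I x^-1 + S x^-2 - S^2 x^-3), meaningful for x <> 0 *)
Definition psi (x z : C) : 'M[C]_3 :=
  cexp (x * z) *: (z%:M - (x^-1)%:M + x^-2 *: Smx - x^-3 *: (Smx *m Smx)).

Definition mpeval (theta : {poly 'M[C]_3}) (x : C) : 'M[C]_3 :=
  \sum_(k < size theta) x ^+ k *: theta`_k.

(* right action of B = sum_j d_z^j . b_j(z), given by its coefficient list b *)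
Definition psiB (b : seq (C -> 'M[C]_3)) (x z : C) : 'M[C]_3 :=
  \sum_(j < size b) (derive1n j (psi x) z) *m (nth (fun _ => 0) b j z).

Definition inA (theta : {poly 'M[C]_3}) : Prop :=
  exists b : seq (C -> 'M[C]_3),
    forall x z : C, x != 0 -> psiB b x z = mpeval theta x *m psi x z.

Definition mx3 (a11 a12 a13 a21 a22 a23 a31 a32 a33 : C) : 'M[C]_3 :=
  \matrix_(i < 3, j < 3)
    nth 0 (nth [::] [:: [:: a11; a12; a13]; [:: a21; a22; a23];
                        [:: a31; a32; a33]] i) j.

(* r k i j stands for r_k^{ij} (k = 0..5, i,j = 1..3) *)
Definition Gamma_coefs (r : nat -> nat -> nat -> C) : seq 'M[C]_3 :=
  [:: mx3 (r 0 1 1) (r 0 1 2) (r 0 1 3)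
          0 (r 0 2 2) (r 0 2 3)
          0 0 (r 0 1 1);
      mx3 (r 1 1 1) (r 1 1 2) (r 1 1 3)
          (r 0 2 2 - r 0 1 1) (r 1 2 2) (r 1 2 3)
          0 (r 0 2 2 - r 0 1 1) (r 1 1 1 + r 0 2 3 - r 0 1 2);
      mx3 (r 2 1 1) (r 2 1 2) (r 2 1 3)
          (r 1 2 2 - r 1 1 1 - r 0 2 3 + r 0 1 2) (r 2 2 2) (r 2 2 3)
          (r 0 2 2 - r 0 1 1) (r 1 2 2 - r 1 1 1) (r 2 1 1 + r 1 2 3 - r 1 1 2);
      mx3 (r 3 1 1) (r 3 1 2) (r 3 1 3)
          (r 3 2 1) (r 3 2 2) (r 3 2 3)
          (r 1 2 2 - 2 * r 1 1 1 - r 0 2 3 + r 0 1 2) (r 3 3 2) (r 3 3 3);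
      mx3 (r 4 1 1) (r 4 1 2) (r 4 1 3)
          (r 4 2 1) (r 4 2 2) (r 4 2 3)
          (r 3 3 2 + r 3 2 1 - r 2 2 2 - r 2 1 1 + r 1 1 2) (r 4 3 2) (r 4 3 3);
      mx3 (r 5 1 1) (r 5 1 2) (r 5 1 3)
          (r 5 2 1) (r 5 2 2) (r 5 2 3)
          (r 4 3 2 + r 4 2 1 - r 3 3 3 - r 3 2 2 - r 3 1 1 + r 2 2 3 + r 2 1 2
             - r 1 1 3) (r 5 3 2) (r 5 3 3)].

Definition inGamma (theta : {poly 'M[C]_3}) : Prop :=
  exists (r : nat -> nat -> nat -> C) (p : {poly 'M[C]_3}),
    theta = Poly (Gamma_coefs r) + 'X^6 * p.

(* Free algebra C<alpha2, alpha3>: an element is a finite formal linear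
   combination of words; in a word, false = alpha2 and true = alpha3. *)
Definition fa := seq (C * seq bool).
Definition fa_coef (p : fa) (w : seq bool) : C := \sum_(t <- p | t.2 == w) t.1.
Definition fa_eq (p q : fa) : Prop := forall w, fa_coef p w = fa_coef q w.
Definition fa_add (p q : fa) : fa := p ++ q.
Definition fa_mul (p q : fa) : fa :=
  [seq (a.1 * b.1, a.2 ++ b.2) | a <- p, b <- q].

Definition rel1 : fa := [:: (1, [:: false; false; false])].
Definition rel2 : fa := [:: (1, [:: true; true]); (-1, [:: true])].
Definition rel3 : fa := [:: (1, [:: true; false; true; false; true]);
                            (-4, [:: true; false; false; true])].
Definition rels (i : 'I_3) : fa := nth [::] [:: rel1; rel2; rel3] i.

Definition inI (p : fa) : Prop :=
  exists s : seq (fa * 'I_3 * fa),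
    fa_eq p (flatten [seq fa_mul (fa_mul t.1.1 (rels t.1.2)) t.2 | t <- s]).

Definition fa_eval (a2 a3 : {poly 'M[C]_3}) (p : fa) : {poly 'M[C]_3} :=
  \sum_(t <- p) ((t.1)%:M)%:P * \prod_(c <- t.2) (if c then a3 else a2).

End Defs.

(* Main.v *)
Require Import Defs.
From HB Require Import structures.
From mathcomp Require Import all_boot all_order all_algebra.
From mathcomp Require Import all_classical all_reals all_analysis.
From mathcomp Require Import complex.
From mathcomp Require Import ring lra.
Import Order.TTheory GRing.Theory Num.Theory.
Import numFieldNormedType.Exports.
Local Open Scope ring_scope.
Local Open Scope complex_scope.

(** With [X = x + S], the bracket in [psi] is [z - X^-1], so [psi B = theta psi]
    reads [(z - X^-1) b + b' = theta (z - X^-1)] for the polynomial [b = sum_j b_j x^j].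
    Eliminating [b] from the coefficients of the lowest powers of [x] at a few values
    of [z] leaves fifteen independent linear conditions on [theta], the ones defining
    Gamma.  They turn out to say [theta = c0 + c1 S + c2 S^2 + X m X] with [c0, c1, c2]
    scalars and [m] an arbitrary matrix polynomial; conversely, for such [theta] one
    may take [b = theta - X g] where [g] is a polynomial solution of
    [z g + g' = m' X + 2 m], which exists for every [z], including [z = 0].

    The generators are [alpha_2 = S] and [alpha_3 = X e_31 X].  Since
    [alpha_3 alpha_2 alpha_3 = 2 x alpha_3], modulo the relations every word is a
    multiple of [S^i] or of [S^i alpha_3 (S alpha_3)^k S^j] with [i, j < 3]; the latter
    evaluates to [(2x)^k X e_(3-i,j+1) X], so the normal forms give a basis. *)

Set Implicit Arguments. Unset Strict Implicit. Unset Printing Implicit Defensive.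

(** * Complex exponential *)

Section Cexp.
Variable R : realType.
Local Notation C := (R[i]).
(* The topology is attached to the numFieldType structure, not to [R[i]] itself. *)
Local Notation K := (R[i] : numFieldType).

(** [cexp] is built from real functions, so its derivative at 0 is obtained from norm estimates;
    this puts real differentiability in a quantitative form that also covers [t = 0]. *)
Lemma is_derive_linear_approx (f : R -> R) (a d e : R) :
  is_derive a 1 f d -> 0 < e ->
  exists2 del : R, 0 < del &
    forall t, `|t| < del -> `|f (t + a) - f a - d * t| <= e * `|t|.
Proof.
move=> [fd <-] e0.
have /cvgrPdist_le /(_ _ e0) : (h^-1 *: ((f \o shift a) (h *: (1:R)) - f a)
   @[h --> 0^'] --> 'D_1 f a)%classic by exact: fd.
case=> del /= del0 H; exists del => // t tdel.
have [->|t0] := eqVneq t 0; first by rewrite add0r subrr mulr0 subr0 normr0 mulr0.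
have := H t; rewrite /= sub0r normrN => /(_ tdel t0).
rewrite -(ler_pM2r (x := `|t|)) ?normr_gt0// -normrM mulrBl /GRing.scale /= mulr1.
rewrite mulrAC mulVf// mul1r distrC; exact.
Qed.

Lemma normc_le_add (u v : R) : `|u +i* v| <= (`|u| + `|v|)%:C.
Proof.
rewrite normc_def /= lecR -[leRHS]ger0_norm ?addr_ge0// -sqrtr_sqr.
by rewrite ler_wsqrtr// sqrrD !real_normK ?num_real// lerD2r lerDl mulrn_wge0// mulr_ge0.
Qed.

Lemma normc_ge_Im (z : C) : `|complex.Im z|%:C <= `|z|.
Proof.
rewrite normc_def lecR -sqrtr_sqr ler_wsqrtr// lerDr; exact: sqr_ge0.
Qed.

Lemma cexp_linear_approx (e : R) : 0 < e ->
  exists2 del : R, 0 < del &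
    forall h : C, `|h| < del%:C -> `|cexp h - 1 - h| <= e%:C * `|h|.
Proof.
(* The bounds on the real and imaginary parts below add up to [n |a| + 8 n |b|], which is at most
   [9 n |h|]; [n <= 1] gives [expR a <= 3]. *)
move=> e0; have [n [n0 n1 n9]] : exists n : R, [/\ 0 < n, n <= 1 & 9 * n <= e].
  exists (Num.min 1 (e / 9)); split; first by rewrite lt_min ltr01/= divr_gt0.
    by rewrite ge_min lexx.
  by rewrite mulrC -ler_pdivlMr// ge_min lexx orbT.
have [d1 d10 H1] := is_derive_linear_approx (is_derive_expR (0 : R)) n0.
have [d2 d20 H2] := is_derive_linear_approx (is_derive_cos (0 : R)) n0.
have [d3 d30 H3] := is_derive_linear_approx (is_derive_sin (0 : R)) n0.
exists (Num.min (Num.min n d1) (Num.min d2 d3)); first by rewrite !lt_min n0 d10 d20.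
case=> a b hdel.
have /= aN := normc_ge_Re (a +i* b); have /= bN := normc_ge_Im (a +i* b).
have := le_lt_trans aN hdel; have := le_lt_trans bN hdel.
rewrite !ltcR !lt_min => /andP[/andP[bn _] /andP[bd2 bd3]] /andP[/andP[an ad1] _].
have := H1 a ad1; have := H2 b bd2; have := H3 b bd3.
rewrite expR0 cos0 sin0 oppr0 mul0r !(addr0, subr0) !mul1r.
set E := expR a; set c := cos b; set s := sin b => Hs Hc HE.
have E0 : 0 <= E := expR_ge0 a.
have a0 := normr_ge0 a; have b0 := normr_ge0 b.
have E1 : `|E - 1| <= 2 * `|a|.
  have -> : E - 1 = (E - 1 - a) + a by ring.
  apply: le_trans (ler_normD _ _) _; apply: le_trans (lerD HE (lexx _)) _; nra.
have E3 : E <= 3.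
  have := ler_norm (E - 1); nra.
have -> : cexp (a +i* b) - 1 - (a +i* b) = (E * c - 1 - a) +i* (E * s - 0 - b) by [].
apply: le_trans (normc_le_add _ _) _.
have HR : `|E * c - 1 - a| <= n * `|a| + 3 * (n * `|b|).
  have -> : E * c - 1 - a = (E - 1 - a) + E * (c - 1) by ring.
  apply: le_trans (ler_normD _ _) _; rewrite normrM (ger0_norm E0).
  by apply: lerD => //; apply: ler_pM.
have HI : `|E * s - 0 - b| <= 3 * (n * `|b|) + 2 * n * `|b|.
  have -> : E * s - 0 - b = E * (s - b) + (E - 1) * b by ring.
  apply: le_trans (ler_normD _ _) _; rewrite !normrM (ger0_norm E0).
  apply: lerD; first by apply: ler_pM.
  apply: ler_pM => //; apply: le_trans E1 _; nra.
have Nr : exists2 N : R, `|a +i* b| = N%:C & 0 <= N.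
  by rewrite normc_def; eexists; first reflexivity; exact: sqrtr_ge0.
case: Nr aN bN => N -> N0; rewrite -rmorphM !lecR => aN bN.
nra.
Qed.

Lemma cexpD (u v : C) : cexp (u + v) = cexp u * cexp v.
Proof.
case: u v => [a b] [c d]; rewrite /cexp /= expRD cosD sinD.
by apply/eqP; rewrite eq_complex /=; apply/andP; split; apply/eqP; ring.
Qed.

Lemma cexp0 : cexp (0 : C) = 1.
Proof. by rewrite /cexp /= expR0 cos0 sin0 mulr1 mulr0. Qed.

Lemma cexp_neq0 (u : C) : cexp u != 0.
Proof.
apply/eqP => u0; have := cexpD u (- u).
by rewrite subrr cexp0 u0 mul0r => /eqP; rewrite oner_eq0.
Qed.

Lemma pos_complex_real (e : C) : 0 < e -> exists2 r : R, e = r%:C & 0 < r.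
Proof.
case: e => a b; rewrite ltcE /= => /andP[/eqP -> a0]; by exists a.
Qed.

Lemma cexp_cvg0 (x : C) :
  ((fun h : K => h^-1 * (cexp (x * h) - 1)) @ (0 : K)^' --> (x : K))%classic.
Proof.
apply/cvgrPdist_le => e /pos_complex_real [r -> r0].
have [N xN N0] : exists2 N : R, `|x| = N%:C & 0 <= N.
  by rewrite normc_def; eexists; first reflexivity; exact: sqrtr_ge0.
(* Dividing by [N + 1] instead of [N] covers [x = 0]. *)
have N1 : 0 < N + 1 by rewrite ltr_wpDl.
have [d d0 H] := cexp_linear_approx (divr_gt0 r0 N1).
exists ((d / (N + 1))%:C) => /=; first by rewrite ltcR divr_gt0.
move=> h /=; rewrite sub0r normrN => hd h0.
have xh : `|x * h| <= (N + 1)%:C * `|h|.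
  by rewrite normrM xN ler_wpM2r// lecR lerDl.
have /H xhd : `|x * h| < d%:C.
  apply: le_lt_trans xh _; move: hd; rewrite -(ltr_pM2l (x := (N + 1)%:C)) ?ltcR//.
  have -> // : (N + 1)%:C * (d / (N + 1))%:C = d%:C.
  by rewrite -rmorphM /= mulrC divfK ?gt_eqF.
have -> : x - h^-1 * (cexp (x * h) - 1) = - h^-1 * (cexp (x * h) - 1 - x * h) by field.
rewrite normrM normrN normfV mulrC ler_pdivrMr ?normr_gt0//.
apply: le_trans xhd _; apply: le_trans (ler_wpM2l _ xh) _.
  by rewrite lecR divr_ge0// ltW.
by rewrite mulrA -rmorphM /= divfK ?gt_eqF.
Qed.

End Cexp.

(** * The derivatives of psi *)

Section PsiDerivatives.
Variable R : realType.
Local Notation C := (R[i]).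
Local Notation K := (R[i] : numFieldType).

(** Functions [e^(xz) (z A + B)] are stable under differentiation, with [A] going to [x A] and [B]
    to [A + x B]. All derivatives of [psi] then follow by induction. *)
Lemma derive1_cexp_affine (V : normedModType K) (x : K) (A B : V) :
  derive1 (fun z : K => cexp (x * z) *: (z *: A + B)) =
  (fun z : K => cexp (x * z) *: (z *: (x *: A) + (A + x *: B))).
Proof.
apply/funext => z; rewrite /derive1.
apply: cvg_lim; first exact: norm_hausdorff.
pose q (h : K) : K := h^-1 * (cexp (x * h) - 1).
(* The difference quotient is rewritten through [q] alone, using [e^(xh) = 1 + h q(h)]. The factor
   [h^-1 * h] stays because it equals 1 only for [h] nonzero. *)
have -> : (fun h : K => h^-1 *: ((fun z : K => cexp (x * z) *: (z *: A + B)) (h + z)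
     - (fun z : K => cexp (x * z) *: (z *: A + B)) z)) =
   (fun h : K => (cexp (x * z) : K) *:
      (((h^-1 * h) * (1 + (h * q h))) *: A + q h *: (z *: A + B))).
  apply/funext => h /=.
  have -> : x * (h + z) = x * z + x * h by ring.
  rewrite cexpD -[(_ * _) *: ((_ + _) *: _ + _)]scalerA -scalerBr scalerA [h^-1 * _]mulrC.
  rewrite -[(_ * h^-1) *: _]scalerA; congr (_ *: _).
  have -> : h * q h = cexp (x * h) - 1.
    rewrite /q; have [->|h0] := eqVneq h 0; last by rewrite mulrA mulfV ?mul1r.
    by rewrite mulr0 cexp0 subrr mul0r.
  rewrite [1 + _]addrC subrK /q -mulrA -!scalerA -scalerDr; congr (_ *: _).
  rewrite scalerBl scale1r scalerDl -addrA scalerDr addrA !scalerA.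
  by rewrite [h * _]mulrC.
have -> : cexp (x * z) *: (z *: (x *: A) + (A + x *: B)) =
   (cexp (x * z) : K) *: ((1 * (1 + 0 * x)) *: A + x *: (z *: A + B)).
  congr (_ *: _); rewrite mul0r addr0 mulr1 scale1r scalerDr !scalerA [z * x]mulrC.
  by rewrite addrCA.
have cq : (q @ (0 : K)^' --> (x : K))%classic := @cexp_cvg0 R x.
have ch : ((fun h : K => h) @ (0 : K)^' --> (0 : K))%classic.
  by apply: cvg_within_filter; exact: cvg_id.
have ci : ((fun h : K => h^-1 * h) @ (0 : K)^' --> (1 : K))%classic.
  apply: cvg_near_cst; exists 1 => //= h _ h0; exact: mulVf.
clearbody q; have FF : Filter (0 : K)^'%classic by typeclasses eauto.
move: cq ch ci FF; move: (0 : K)^'%classic => F cq ch ci FF.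
have c3 : (((fun h : K => h^-1 * h * (1 + h * q h)) : K -> K) @ F
    --> (1 * (1 + 0 * x) : K))%classic.
  apply: (@cvgM _ _ _ FF _ _ _ _ ci); apply: (@cvgD _ _ _ _ FF); first exact: cvg_cst.
  exact: (@cvgM _ _ _ FF _ _ _ _ ch cq).
have c6 := @cvgD _ _ _ _ FF _ _ _ _ (@cvgZr_tmp _ _ _ _ FF _ _ A c3)
   (@cvgZr_tmp _ _ _ _ FF _ _ (z *: A + B) cq).
apply: (@cvgZ _ _ _ _ FF (fun=> cexp (x * z)) _ _ _ _ c6).
exact: cvg_cst.
Qed.

(* The inverse of [x + S], expanded with [S^3 = 0]. *)
Definition invXS (x : C) : 'M[C]_3 :=
  (x^-1)%:M - x^-2 *: @Smx R + x^-3 *: (@Smx R *m @Smx R).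

(** Leibniz's rule: the second factor is affine in [z], so two terms survive. At [j = 0] the factor
    [j%:R] cancels the term with the truncated exponent. *)
Lemma derive1n_psi (x : K) j z :
  derive1n j (psi x) z =
  cexp (x * z) *: ((x ^+ j *: (z%:M - invXS x)) + (j%:R * x ^+ j.-1)%:M).
Proof.
have -> : derive1n j (psi x) = fun z : K => cexp (x * z) *:
  (z *: (x ^+ j *: (1%:M : 'M[C]_3)) + ((j%:R * x ^+ j.-1)%:M - x ^+ j *: invXS x)).
  elim: j => [|j IH].
    apply/funext => t; rewrite derive1n0 /psi /invXS expr0 mul0r !scale1r.
    by rewrite scalemx1 raddf0 sub0r !opprD opprK !addrA.
  rewrite derive1nS IH (derive1_cexp_affine x (x ^+ j *: (1%:M : 'M[C]_3))
    ((j%:R * x ^+ j.-1)%:M - x ^+ j *: invXS x)).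
  rewrite scalerA -exprS; apply/funext => t.
  rewrite [x *: (_ - _)]scalerBr [x *: (_ *: invXS x)]scalerA -exprS
    [x ^+ j *: _ + (_ - _)]addrA.
  suff -> : x ^+ j *: 1%:M + x *: (j%:R * x ^+ j.-1)%:M = (j.+1%:R * x ^+ j)%:M :> 'M[C]_3 by [].
  rewrite scalemx1 scale_scalar_mx -raddfD /=; congr (_%:M).
  by case: j {IH} => [|j] /=; rewrite ?exprS; ring.
by rewrite scalerBr !scalemx1 !scale_scalar_mx [z * _]mulrC addrA addrAC.
Qed.

End PsiDerivatives.

(** * Matrix polynomials and the eigenvalue equation *)

Section Eigen.
Variable R : realType.
Local Notation C := (R[i]).
Local Notation M3 := 'M[C]_3.
Local Notation P := {poly M3}.
Local Notation S := (@Smx R).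

(** * Arithmetic of explicit 3 by 3 matrices *)

Lemma mx3_eta (A : M3) :
  A = mx3 (A 0 0) (A 0 1) (A 0 2) (A 1 0) (A 1 1) (A 1 2) (A 2 0) (A 2 1) (A 2 2).
Proof.
apply/matrixP => i j; rewrite mxE.
by case: i => [[|[|[|//]]] hi]; case: j => [[|[|[|//]]] hj] /=; congr (A _ _); apply: val_inj.
Qed.

Lemma eq_mx3 (a b c d e f g h i a' b' c' d' e' f' g' h' i' : C) :
  mx3 a b c d e f g h i = mx3 a' b' c' d' e' f' g' h' i' ->
  [/\ [/\ a = a', b = b' & c = c'], [/\ d = d', e = e' & f = f'] &
     [/\ g = g', h = h' & i = i']].
Proof.
move=> /matrixP H.
by split; split; [have := H 0 0|have := H 0 1|have := H 0 2|have := H 1 0|have := H 1 1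
  |have := H 1 2|have := H 2 0|have := H 2 1|have := H 2 2]; rewrite !mxE.
Qed.

Lemma mx3M (a b c d e f g h i a' b' c' d' e' f' g' h' i' : C) :
  mx3 a b c d e f g h i * mx3 a' b' c' d' e' f' g' h' i' =
  mx3 (a * a' + b * d' + c * g') (a * b' + b * e' + c * h') (a * c' + b * f' + c * i')
      (d * a' + e * d' + f * g') (d * b' + e * e' + f * h') (d * c' + e * f' + f * i')
      (g * a' + h * d' + i * g') (g * b' + h * e' + i * h') (g * c' + h * f' + i * i').
Proof.
apply/matrixP => k l; rewrite -mulmxE !mxE !big_ord_recl big_ord0 !mxE /= addr0 addrA.
by case: k => [[|[|[|//]]] hk]; case: l => [[|[|[|//]]] hl].
Qed.

Lemma mx3D (a b c d e f g h i a' b' c' d' e' f' g' h' i' : C) :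
  mx3 a b c d e f g h i + mx3 a' b' c' d' e' f' g' h' i' =
  mx3 (a + a') (b + b') (c + c') (d + d') (e + e') (f + f') (g + g') (h + h') (i + i').
Proof.
apply/matrixP => k l; rewrite !mxE.
by case: k => [[|[|[|//]]] hk]; case: l => [[|[|[|//]]] hl].
Qed.

Lemma mx3N (a b c d e f g h i : C) :
  - mx3 a b c d e f g h i = mx3 (- a) (- b) (- c) (- d) (- e) (- f) (- g) (- h) (- i).
Proof.
apply/matrixP => k l; rewrite !mxE.
by case: k => [[|[|[|//]]] hk]; case: l => [[|[|[|//]]] hl].
Qed.

Lemma mx3Z (x a b c d e f g h i : C) :
  x *: mx3 a b c d e f g h i =
  mx3 (x * a) (x * b) (x * c) (x * d) (x * e) (x * f) (x * g) (x * h) (x * i).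
Proof.
apply/matrixP => k l; rewrite !mxE.
by case: k => [[|[|[|//]]] hk]; case: l => [[|[|[|//]]] hl].
Qed.

Lemma mx3_0 : 0 = mx3 0 0 0 0 0 0 0 0 0 :> M3.
Proof.
apply/matrixP => k l; rewrite !mxE.
by case: k => [[|[|[|//]]] hk]; case: l => [[|[|[|//]]] hl].
Qed.

Lemma mx3_1 : 1 = mx3 1 0 0 0 1 0 0 0 1 :> M3.
Proof.
apply/matrixP => k l; rewrite !mxE.
by case: k => [[|[|[|//]]] hk]; case: l => [[|[|[|//]]] hl].
Qed.

Lemma mx3S : S = mx3 0 1 0 0 0 1 0 0 0.
Proof.
apply/matrixP => k l; rewrite !mxE.
by case: k => [[|[|[|//]]] hk]; case: l => [[|[|[|//]]] hl]; rewrite /= ?addr0 ?add0r.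
Qed.

Lemma mx3Sl (a b c d e f g h i : C) :
  S * mx3 a b c d e f g h i = mx3 d e f g h i 0 0 0.
Proof. by rewrite mx3S mx3M !(mul0r, mul1r, add0r, addr0). Qed.

Lemma mx3Sr (a b c d e f g h i : C) :
  mx3 a b c d e f g h i * S = mx3 0 a b 0 d e 0 g h.
Proof. by rewrite mx3S mx3M !(mulr0, mulr1, add0r, addr0). Qed.

Lemma mx3SSl (a b c d e f g h i : C) :
  S * S * mx3 a b c d e f g h i = mx3 g h i 0 0 0 0 0 0.
Proof. by rewrite -mulrA !mx3Sl. Qed.

Lemma Smx3 : S * S * S = 0.
Proof. by rewrite {1}mx3S !mx3Sr -mx3_0. Qed.

(** * The polynomial X and its cofactor Y *)

Definition Xp : P := 'X + S%:P.

(* [x^3 (x + S)^-1] *)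
Definition Yp : P := 'X^2 - S%:P * 'X + (S * S)%:P.

Lemma commXpoly (p : P) n : 'X^n * p = p * 'X^n.
Proof. by rewrite (commr_polyXn p n). Qed.

Lemma mul_sum_cubes (A : nzRingType) (x s : A) :
  GRing.comm s x -> s * s * s = 0 -> (x + s) * (x ^+ 2 - s * x + s * s) = x ^+ 3.
Proof.
move=> c s3.
have e1 : x * (s * x) = s * (x ^+ 2) by rewrite mulrA -c -mulrA.
have e2 : x * (s * s) = s * (s * x) by rewrite mulrA -c -mulrA -c.
have e3 : s * (s * s) = 0 by rewrite mulrA.
rewrite mulrDl !mulrDr !mulrN e1 e2 e3 addr0 -exprS.
by rewrite addrA -[_ + s * (s * x) + _]addrA [s * (s * x) + _]addrC addrA subrK addrK.
Qed.

Lemma XpYp : Xp * Yp = 'X^3.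
Proof.
rewrite /Xp /Yp polyCM mul_sum_cubes //; first exact: commr_polyX.
by rewrite -!polyCM Smx3.
Qed.

Lemma YpXp : Yp * Xp = 'X^3.
Proof.
rewrite -XpYp; have c : GRing.comm S%:P ('X : P) by exact: commr_polyX.
have cX : GRing.comm Xp 'X by exact: commr_polyX.
have cS : GRing.comm Xp S%:P.
  by apply: GRing.commr_sym; apply: GRing.commrD.
rewrite /Yp polyCM; apply: GRing.commr_sym; apply: GRing.commrD; last exact: GRing.commrM.
apply: GRing.commrB; first exact: GRing.commrX.
exact: GRing.commrM.
Qed.

Lemma scalar_mx_comm (x : C) (A : M3) : x%:M * A = A * x%:M.
Proof. by rewrite -!mulmxE scalar_mxC. Qed.

(** Over a noncommutative coefficient ring evaluation need not be multiplicative; it is at scalar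
    matrices, which are central. *)
Lemma hornerM_scalar (p q : P) (x : C) : (p * q).[x%:M] = p.[x%:M] * q.[x%:M].
Proof. by apply: hornerM_comm; exact: scalar_mx_comm. Qed.

Lemma mpevalE (theta : P) (x : C) : mpeval theta x = theta.[x%:M].
Proof.
rewrite horner_coef; apply: eq_bigr => k _.
by rewrite -rmorphXn /= -mulmxE mul_mx_scalar.
Qed.

(** Each matrix entry gives a scalar polynomial [q] with the distinct roots 1, ..., [size q], more
    than its degree allows. *)
Lemma poly_mx_eq0 (p : P) : (forall x : C, x != 0 -> p.[x%:M] = 0) -> p = 0.
Proof.
move=> H; apply/polyP => k; apply/matrixP => i j; rewrite coef0 mxE.
pose q : {poly C} := \poly_(k < size p) (p`_k i j).
have -> : p`_k i j = q`_k.
  rewrite coef_poly; case: ltnP => // h; by rewrite nth_default // mxE.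
suff -> : q = 0 by rewrite coef0.
apply: (@roots_geq_poly_eq0 _ q [seq n.+1%:R | n <- iota 0 (size q)]).
- apply/allP => _ /mapP [n _ ->]; apply/rootP.
  have n0 : n.+1%:R != 0 :> C by rewrite pnatr_eq0.
  have /matrixP /(_ i j) := H _ n0.
  rewrite mxE -mpevalE summxE /q horner_poly => E; rewrite -[RHS]E.
  by apply: eq_bigr => l _; rewrite mxE mulrC.
- rewrite map_inj_uniq ?iota_uniq // => a b /eqP.
  by rewrite eqr_nat => /eqP [].
- by rewrite size_map size_iota.
Qed.

Lemma Yp_horner (x : C) : x != 0 -> Yp.[x%:M] = x ^+ 3 *: invXS x.
Proof.
move=> x0.
have e1 : x ^+ 3 * x^-1 = x ^+ 2 by rewrite exprSr mulfK.
have e2 : x ^+ 3 * x ^- 2 = x by rewrite exprS mulfK ?expf_neq0.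
have e3 : x ^+ 3 * x ^- 3 = 1 by rewrite mulfV ?expf_neq0.
rewrite /invXS scalerDr scalerBr !scalerA scale_scalar_mx e1 e2 e3 scale1r.
rewrite /Yp !hornerD hornerN hornerC hornerXn hornerM_scalar hornerC hornerX.
by rewrite -rmorphXn /= -!mulmxE mul_mx_scalar.
Qed.

Lemma psiE (x z : C) : psi x z = cexp (x * z) *: (z%:M - invXS x).
Proof.
by rewrite -[psi x z]/(derive1n 0 (psi x) z) derive1n_psi expr0 mul0r scale1r raddf0 addr0.
Qed.

(** For fixed [z] the coefficients [b_j(z)] form a polynomial [p] in [x]. The terms [x^j] and
    [j x^(j-1)] of [derive1n_psi] then sum to [p] and its derivative. *)
Lemma psiBE (b : seq (C -> M3)) (x z : C) (p : P) :
  p = \poly_(j < size b) nth (fun=> 0) b j z ->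
  psiB b x z = cexp (x * z) *: ((z%:M - invXS x) * p.[x%:M] + p^`().[x%:M]).
Proof.
move=> ->; rewrite poly_def raddf_sum !horner_sum mulr_sumr -big_split /= scaler_sumr.
apply: eq_bigr => j _; rewrite derive1n_psi -scalemxAl; congr (_ *: _).
rewrite derivZ derivXn !hornerZ hornerXn hornerMn hornerXn mulmxDl.
set B := nth _ b j z.
have mulM (A : M3) (c : C) : A * c%:M = c *: A by rewrite -mulmxE mul_mx_scalar.
rewrite -[(x%:M ^+ j : M3)](rmorphXn (@scalar_mx C 3)).
rewrite -[(x%:M ^+ j.-1 : M3)](rmorphXn (@scalar_mx C 3)).
rewrite /= -[(_%:M *+ j)](raddfMn (@scalar_mx C 3)) !mulM -scalemxAl mulmxE -scalerAr.
by rewrite -mulmxE mul_scalar_mx mulr_natl.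
Qed.

(** The coefficients of an operator are arbitrary functions of [z], so the polynomials [b z] are
    tied together only by the common bound [N] on the order. *)
Lemma inAP (theta : P) : inA theta <->
  exists N (b : C -> P), (forall z, (size (b z) <= N)%N) /\
    forall x z : C, x != 0 ->
      (z%:M - invXS x) * (b z).[x%:M] + (b z)^`().[x%:M]
      = theta.[x%:M] * (z%:M - invXS x).
Proof.
split=> [[b Hb]|[N [b [sb Hb]]]].
  exists (size b), (fun z => \poly_(j < size b) nth (fun=> 0) b j z); split=> [z|x z x0].
    exact: size_poly.
  have := Hb x z x0; rewrite (psiBE x erefl) psiE mpevalE -scalemxAr.
  by move/(scalerI (cexp_neq0 _)).
exists (mkseq (fun j z => (b z)`_j) N) => x z x0.
rewrite (@psiBE _ x z (b z)); last first.
  apply/polyP => k; rewrite coef_poly size_mkseq; case: ltnP => h.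
    by rewrite nth_mkseq.
  by rewrite nth_default // (leq_trans (sb z)).
by rewrite Hb // psiE mpevalE -scalemxAr.
Qed.

End Eigen.

(** * Elimination of the operator *)

(** Subtracts [c] times a hypothesis from the goal; a chain of such steps ending in [ring] or
    [field] is a certificate of linear dependence. *)
Lemma lincomb (K : comNzRingType) (c u v x y : K) : u = v -> x - c * (u - v) = y -> x = y.
Proof. by move=> ->; rewrite subrr mulr0 subr0. Qed.

Section Elimination.
Variable R : realType.
Local Notation C := (R[i]).
Local Notation M3 := 'M[C]_3.
Local Notation P := {poly M3}.
Local Notation S := (@Smx R).
Local Notation Y := (Yp R).

(** Multiplying by [x^3] turns [invXS x] into [Y], and an equality at all nonzero [x] is an equality
    of polynomials. *)
Lemma inA_poly (theta : P) (z : C) : inA theta ->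
  exists b : P, 'X^3 * ((z%:M)%:P * b + b^`()) - Y * b = theta * ((z%:M)%:P * 'X^3 - Y).
Proof.
move=> /inAP [N [b [_ H]]]; exists (b z); apply/eqP; rewrite -subr_eq0; apply/eqP.
apply: poly_mx_eq0 => x x0; have {}H := H x z x0.
have e : forall A : M3, (x%:M ^+ 3) * A = x ^+ 3 *: A.
  by move=> A; rewrite -rmorphXn /= -mulmxE mul_scalar_mx.
have := Yp_horner x0; move: (Yp R) => y ey.
rewrite !(hornerXn, hornerC, hornerD, hornerN, hornerM_scalar) ey e.
have -> : z%:M * x%:M ^+ 3 = x ^+ 3 *: z%:M :> M3.
  by rewrite -[x%:M ^+ 3]mulr1 e -scalerAr mulr1.
by rewrite -scalerAl -!scalerBr addrAC -mulrBl H -scalerAr subrr.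
Qed.

Lemma coefYl (p : P) n : (Y * p)`_n =
  (if (n < 2)%N then 0 else p`_(n - 2)) - (if n == 0%N then 0 else S * p`_n.-1) + S * S * p`_n.
Proof.
rewrite /Yp; move: S => s; rewrite mulrDl mulrBl -[s%:P * 'X * p]mulrA.
by rewrite !(coefD, coefN, coefXnM, coefCM, coefXM); case: n => //=; rewrite mulr0.
Qed.

Lemma coefYr (p : P) n : (p * Y)`_n =
  (if (n < 2)%N then 0 else p`_(n - 2)) - (if n == 0%N then 0 else p`_n.-1 * S) + p`_n * S * S.
Proof.
rewrite /Yp; move: S => s; rewrite mulrDr mulrBr [p * (s%:P * 'X)]mulrA.
by rewrite !(coefD, coefN, coefMXn, coefMC, coefMX) mulrA.
Qed.

(* The coefficient of [x^n] in [x^3 theta' + theta Y - Y theta]. *)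
Definition Tcoef (theta : P) (n : nat) : M3 :=
  (if (n < 2)%N then 0 else theta`_(n - 2) *+ (n - 2)) + theta`_n * S * S - S * S * theta`_n
  + (if n == 0%N then 0 else S * theta`_n.-1 - theta`_n.-1 * S).

Lemma coef_eigen (theta b : P) (z : C) n :
  'X^3 * ((z%:M)%:P * b + b^`()) - Y * b = theta * ((z%:M)%:P * 'X^3 - Y) ->
  (if (n < 3)%N then 0 else z *: b`_(n - 3) + b`_(n - 2) *+ (n - 2)) - (Y * b)`_n =
  (if (n < 3)%N then 0 else z *: theta`_(n - 3)) - (theta * Y)`_n.
Proof.
rewrite mulrBr mulrA => /polyP /(_ n); move: (Yp R) => y.
rewrite !(coefD, coefN, coefXnM, coefMXn, coefMC, coefCM, coef_deriv).
rewrite -!mulmxE mul_scalar_mx mul_mx_scalar => <-; case: ltnP => // h.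
by rewrite -subSn.
Qed.

(* The coefficient of [x^n] in [Y * sum_k T_k x^k]. *)
Local Notation Lam T n := (S * S * T n + (if n is k.+1 then - (S * T k) else 0)
   + (if n is k.+2 then T k else 0)).

(** Put [d = theta - b]. The equation becomes [T = x^3 (z d + d') - Y d] with
    [T = x^3 theta' + theta Y - Y theta], whose left side does not involve [z]. *)
Lemma Tcoef_rec (theta : P) (z : C) : inA theta -> exists d : nat -> M3,
  let T := Tcoef theta in
  [/\ T 0%N = - (S * S * d 0%N), T 1%N = - (S * S * d 1%N) + S * d 0%N &
     T 2%N = - (S * S * d 2%N) + S * d 1%N - d 0%N] /\
  [/\ T 3%N = z *: d 0%N - S * S * d 3%N + S * d 2%N,
     T 4%N = z *: d 1%N + d 2%N - S * S * d 4%N + S * d 3%N &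
     T 5%N = z *: d 2%N + d 3%N *+ 2 - S * S * d 5%N + S * d 4%N].
Proof.
move=> /(inA_poly z) [b H]; exists (fun n => theta`_n - b`_n).
have := fun n => coef_eigen n H.
move=> E; have := E 0%N; have := E 1%N; have := E 2%N.
have := E 3%N; have := E 4%N; have := E 5%N.
rewrite /Tcoef !coefYl !coefYr /= !(subSS, subn0); move: S => s {E H}.
move: (nth 0 (polyseq theta)) (nth 0 (polyseq b)) => t u E5 E4 E3 E2 E1 E0.
(* The remaining identities are additive, so they are checked entrywise, where [ring] applies. *)
have eD (A B : M3) i j : (A + B) i j = A i j + B i j by rewrite mxE.
have eN (A : M3) i j : (- A) i j = - A i j by rewrite mxE.
have e0 i j : (0 : M3) i j = 0 by rewrite mxE.
have eM (A : M3) i j n : (A *+ n) i j = A i j *+ n by rewrite mulmxnE.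
have eZ (A : M3) i j : (z *: A) i j = z * A i j by rewrite mxE.
split; split; apply/matrixP => i j;
  [move/matrixP/(_ i j): E0 | move/matrixP/(_ i j): E1 | move/matrixP/(_ i j): E2
  |move/matrixP/(_ i j): E3 | move/matrixP/(_ i j): E4 | move/matrixP/(_ i j): E5];
  rewrite !mulrBr !(eD, eN, eM, eZ, e0) => /(lincomb (c := 1)); apply; ring.
Qed.

(** Here [Y T = x^3 Y (z d + d') - Y^2 d], and [S^3 = 0] gives [Y^2 = x^4 - 2 S x^3 + 3 S^2 x^2], so
    the coefficients 0 and 1 of [Y T] vanish. Coefficients 2 to 5 involve only [d_0], [d_1], [d_2],
    which cancel in the stated combination. *)
Lemma Lam_elim (z : C) (d T : nat -> M3) :
  [/\ T 0%N = - (S * S * d 0%N), T 1%N = - (S * S * d 1%N) + S * d 0%N &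
     T 2%N = - (S * S * d 2%N) + S * d 1%N - d 0%N] ->
  [/\ T 3%N = z *: d 0%N - S * S * d 3%N + S * d 2%N,
     T 4%N = z *: d 1%N + d 2%N - S * S * d 4%N + S * d 3%N &
     T 5%N = z *: d 2%N + d 3%N *+ 2 - S * S * d 5%N + S * d 4%N] ->
  [/\ Lam T 0%N = 0, Lam T 1%N = 0 &
    z ^+ 3 *: Lam T 2%N + 3 * z ^+ 2 *: Lam T 3%N + (6 * z) *: Lam T 4%N +
    6 *: Lam T 5%N = 0].
Proof.
move=> [-> -> ->] [-> -> ->].
rewrite [d 3%N *+ 2]mulr2n.
rewrite [d 0%N]mx3_eta [d 1%N]mx3_eta [d 2%N]mx3_eta.
rewrite [d 3%N]mx3_eta [d 4%N]mx3_eta [d 5%N]mx3_eta.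
rewrite -!mulrA mx3_0 !(mx3Sl, mx3D, mx3N, mx3Z).
by split; congr mx3; ring.
Qed.

Lemma cubic_eq0 (a b c d : C) :
  (forall z : C, z ^+ 3 * a + 3 * z ^+ 2 * b + (6 * z) * c + 6 * d = 0) ->
  [/\ a = 0, b = 0, c = 0 & d = 0].
Proof.
move=> H; have H0 := H 0; have H1 := H 1; have H2 := H (-1); have H3 := H 2.
have c0 n x : n.+1%:R * x = 0 -> x = 0 :> C.
  by move/eqP; rewrite mulf_eq0 pnatr_eq0 /= => /eqP.
(* The values at 0, 1, -1 and 2 are combined to isolate [6 a], [6 b], [36 c] and [6 d]. *)
split.
- apply: (c0 5); apply: (lincomb (c := 1) H3); apply: (lincomb (c := -3) H1).
  by apply: (lincomb (c := -1) H2); apply: (lincomb (c := 3) H0); ring.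
- apply: (c0 5); apply: (lincomb (c := 1) H1); apply: (lincomb (c := 1) H2).
  by apply: (lincomb (c := -2) H0); ring.
- apply: (c0 35); apply: (lincomb (c := 6) H1); apply: (lincomb (c := -2) H2).
  by apply: (lincomb (c := -1) H3); apply: (lincomb (c := -3) H0); ring.
- by apply: (c0 5); apply: (lincomb (c := 1) H0); ring.
Qed.

Lemma cubic_mx_eq0 (A2 A3 A4 A5 : M3) :
  (forall z : C, z ^+ 3 *: A2 + 3 * z ^+ 2 *: A3 + (6 * z) *: A4 + 6 *: A5 = 0) ->
  [/\ A2 = 0, A3 = 0, A4 = 0 & A5 = 0].
Proof.
move=> L; have E i j : [/\ A2 i j = 0, A3 i j = 0, A4 i j = 0 & A5 i j = 0].
  by apply: cubic_eq0 => z; have /matrixP /(_ i j) := L z; rewrite !mxE.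
by split; apply/matrixP => i j; have [] := E i j; rewrite mxE.
Qed.

(** Although [d] varies with [z], [Tcoef theta] does not, so the combination of [Lam_elim] is a
    cubic polynomial in [z] that vanishes identically. *)
Lemma Lam_eq0 (theta : P) : inA theta -> forall n, (n < 6)%N -> Lam (Tcoef theta) n = 0.
Proof.
move=> H.
have L : forall z, [/\ Lam (Tcoef theta) 0%N = 0, Lam (Tcoef theta) 1%N = 0 &
    z ^+ 3 *: Lam (Tcoef theta) 2%N + 3 * z ^+ 2 *: Lam (Tcoef theta) 3%N +
    (6 * z) *: Lam (Tcoef theta) 4%N + 6 *: Lam (Tcoef theta) 5%N = 0].
  by move=> z; have [d [Td1 Td2]] := Tcoef_rec z H; exact: Lam_elim Td1 Td2.
have [L0 L1 _] := L 0.
have [] := @cubic_mx_eq0 _ _ _ _ (fun z => let: And3 _ _ h := L z in h).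
move=> L2 L3 L4 L5 [|[|[|[|[|[|n]]]]]] n6; last by clear -n6.
- exact: L0.
- exact: L1.
- exact: L2.
- exact: L3.
- exact: L4.
- exact: L5.
Qed.
Lemma Lam_Gamma (theta : P) :
  (forall n, (n < 6)%N -> Lam (Tcoef theta) n = 0) -> inGamma theta.
Proof.
move=> L.
have [t Ht] : exists t : nat -> M3, forall n, theta`_n = t n by exists (fun n => theta`_n).
have := L 0%N isT; have := L 1%N isT; have := L 2%N isT; have := L 3%N isT.
have := L 4%N isT; have := L 5%N isT.
rewrite /Tcoef !Ht /= !(subSS, subn0).
rewrite mulr0n mulr1n [t 2%N *+ 2]mulr2n [t 3%N *+ 3]mulrS [t 3%N *+ 2]mulr2n.
rewrite [t 0%N]mx3_eta [t 1%N]mx3_eta [t 2%N]mx3_eta.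
rewrite [t 3%N]mx3_eta [t 4%N]mx3_eta [t 5%N]mx3_eta mx3_0.
rewrite !(mx3SSl, mx3Sl, mx3Sr, mx3D, mx3N) => L5 L4 L3 L2 L1 L0.
(* Fifteen entries are kept, [e] followed by [n], [i], [j] being entry [(i, j)] of condition [n].
   Solving them for the fifteen dependent entries of [theta] gives the multipliers below. *)
have [[_ _ e013] [_ _ _] [_ _ _]] := eq_mx3 L0.
have [[_ _ e113] [_ _ _] [_ _ _]] := eq_mx3 L1.
have [[_ e212 e213] [_ _ _] [_ _ _]] := eq_mx3 L2.
have [[_ e312 e313] [_ _ e323] [_ _ e333]] := eq_mx3 L3.
have [[_ e412 e413] [_ _ e423] [_ _ e433]] := eq_mx3 L4.
have [[_ _ e513] [_ _ e523] [_ _ e533]] := eq_mx3 L5.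
have t021 : t 0%N 1 0 = 0.
  by apply: (lincomb (c := 1) e333); apply: (lincomb (c := -1) e113); ring.
have t031 : t 0%N 2 0 = 0.
  by apply: (lincomb (c := 1) e013); ring.
have t032 : t 0%N 2 1 = 0.
  by apply: (lincomb (c := -1 / 3) e212); apply: (lincomb (c := -1 / 3) e113); field.
have t033 : t 0%N 2 2 = t 0%N 0 0.
  by apply: (lincomb (c := -1) e323); apply: (lincomb (c := -1) e213); ring.
have t121 : t 1%N 1 0 = t 0%N 1 1 - t 0%N 0 0.
  by apply: (lincomb (c := 1) e433); apply: (lincomb (c := 1) e213);
    apply: (lincomb (c := 2) e323); ring.
have t131 : t 1%N 2 0 = 0.
  by apply: (lincomb (c := -1 / 3) e113); apply: (lincomb (c := -1 / 3) e212);
    apply: (lincomb (c := 1) e333); field.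
have t132 : t 1%N 2 1 = t 0%N 1 1 - t 0%N 0 0.
  by apply: (lincomb (c := -1 / 2) e312); apply: (lincomb (c := 1 / 2) e213);
    apply: (lincomb (c := 1) e323); field.
have t133 : t 1%N 2 2 = t 1%N 0 0 + t 0%N 1 2 - t 0%N 0 1.
  by apply: (lincomb (c := -1) e423); apply: (lincomb (c := -1) e313); ring.
have t221 : t 2%N 1 0 = t 1%N 1 1 - t 1%N 0 0 - t 0%N 1 2 + t 0%N 0 1.
  by apply: (lincomb (c := 1) e533); apply: (lincomb (c := 1) e313);
    apply: (lincomb (c := 2) e423); ring.
have t231 : t 2%N 2 0 = t 0%N 1 1 - t 0%N 0 0.
  by apply: (lincomb (c := 1 / 2) e213); apply: (lincomb (c := -1 / 2) e312);
    apply: (lincomb (c := 1) e323); apply: (lincomb (c := 1) e433); field.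
have t232 : t 2%N 2 1 = t 1%N 1 1 - t 1%N 0 0.
  by apply: (lincomb (c := -1) e412); apply: (lincomb (c := 1) e423); ring.
have t233 : t 2%N 2 2 = t 2%N 0 0 + t 1%N 1 2 - t 1%N 0 1.
  by apply: (lincomb (c := -1) e523); apply: (lincomb (c := -1) e413); ring.
have t331 : t 3%N 2 0 = t 1%N 1 1 - 2 * t 1%N 0 0 - t 0%N 1 2 + t 0%N 0 1.
  by apply: (lincomb (c := -1) e412); apply: (lincomb (c := 1) e533);
    apply: (lincomb (c := 1) e313); apply: (lincomb (c := 2) e423); ring.
have t431 : t 4%N 2 0 = t 3%N 2 1 + t 3%N 1 0 - t 2%N 1 1 - t 2%N 0 0 + t 1%N 0 1.
  by apply: (lincomb (c := 1) e413); ring.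
have t531 : t 5%N 2 0 = t 4%N 2 1 + t 4%N 1 0 - t 3%N 2 2 - t 3%N 1 1 - t 3%N 0 0
    + t 2%N 1 2 + t 2%N 0 1 - t 1%N 0 2.
  by apply: (lincomb (c := 1) e513); ring.
(* The variables of [Gamma_coefs] are indexed from 1, matrix entries from 0. *)
pose o (k : nat) : 'I_3 := nth 0 [:: 0; 1; 2] k.-1.
pose r (k i j : nat) : C := t k (o i) (o j).
exists r, (drop_poly 6 theta).
apply/polyP => k; rewrite coefD coef_Poly coefXnM coef_drop_poly /Gamma_coefs.
case: k => [|[|[|[|[|[|k]]]]]]; rewrite /= ?addr0;
  last by rewrite nth_nil add0r subnK.
all: by rewrite Ht [LHS]mx3_eta; congr mx3.
Qed.

End Elimination.

(** * The intermediate description of the algebra *)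

Section Intermediate.
Variable R : realType.
Local Notation C := (R[i]).
Local Notation M3 := 'M[C]_3.
Local Notation P := {poly M3}.
Local Notation S := (@Smx R).
Local Notation X := (Xp R).
Local Notation Y := (Yp R).

Definition Spoly (c0 c1 c2 : C) : M3 := c0%:M + c1 *: S + c2 *: (S * S).

Lemma Spoly_mx3 (c0 c1 c2 : C) : Spoly c0 c1 c2 = mx3 c0 c1 c2 0 c0 c1 0 0 c0.
Proof.
have eSS : S * S = mx3 0 0 1 0 0 0 0 0 0 by rewrite [X in _ * X]mx3S mx3Sl.
rewrite /Spoly eSS mx3S -scalemx1 -[1%:M]/(1 : M3) mx3_1 !(mx3Z, mx3D).
by rewrite !(mulr0, mulr1, addr0, add0r).
Qed.

Definition inXMX (theta : P) : Prop := exists (c0 c1 c2 : C) (m : P),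
  theta = (Spoly c0 c1 c2)%:P + X * m * X.

Lemma polyXn_inj n (p q : P) : 'X^n * p = 'X^n * q -> p = q.
Proof.
move=> /polyP H; apply/polyP => k; have := H (n + k)%N.
by rewrite !coefXnM ltnNge leq_addr /= addKn.
Qed.

(** Since [X Y = Y X = x^3], the equation [theta - c = X m X] amounts to [Y (theta - c) Y = x^6 m],
    so [m] exists once the six lowest coefficients vanish. *)
Lemma low_coefs_inXMX (theta : P) c0 c1 c2 :
  (forall n, (n < 6)%N -> (Y * (theta - (Spoly c0 c1 c2)%:P) * Y)`_n = 0) -> inXMX theta.
Proof.
move=> H; exists c0, c1, c2, (drop_poly 6 (Y * (theta - (Spoly c0 c1 c2)%:P) * Y)).
move: H; move: (Spoly _ _ _)%:P => c H.
have eM : Y * (theta - c) * Y = 'X^6 * drop_poly 6 (Y * (theta - c) * Y).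
  apply/polyP => n; rewrite coefXnM coef_drop_poly; case: ltnP => [/H //|h].
  by rewrite subnK.
apply/eqP; rewrite addrC -subr_eq; apply/eqP; apply: (@polyXn_inj 6).
have -> : 'X^6 * (X * drop_poly 6 (Y * (theta - c) * Y) * X) =
   X * ('X^6 * drop_poly 6 (Y * (theta - c) * Y)) * X.
  by rewrite [X * ('X^6 * _)]mulrA -[X * 'X^6]commXpoly !mulrA.
by rewrite -eM !mulrA XpYp -!mulrA YpXp -commXpoly !mulrA.
Qed.

Lemma Gamma_inXMX (theta : P) : inGamma theta -> inXMX theta.
Proof.
move=> [r [p e]].
have E n : (n < 6)%N -> theta`_n = (Gamma_coefs r)`_n.
  by move=> n6; rewrite e coefD coef_Poly coefXnM n6 addr0.
(* These are combinations of first-row entries to which [X m X] contributes nothing, so they recover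
   the coefficients of [S] and [S^2]. *)
pose c1 := r 0%N 1%N 2%N - r 1%N 1%N 1%N.
pose c2 := r 0%N 1%N 3%N - r 1%N 1%N 2%N + r 2%N 1%N 1%N.
apply: (@low_coefs_inXMX theta (r 0%N 1%N 1%N) c1 c2).
move: (E 0%N isT) (E 1%N isT) (E 2%N isT) (E 3%N isT) (E 4%N isT) (E 5%N isT).
rewrite Spoly_mx3 /c1 /c2 /= => E0 E1 E2 E3 E4 E5 n n6.
set c := mx3 _ _ _ _ _ _ _ _ _.
have [t T0 T1] : exists2 t : P, t = theta - c%:P &
    forall n, t`_n = theta`_n - (if n == 0%N then c else 0).
  by eexists; [reflexivity|move=> k; rewrite coefB coefC].
rewrite -T0 {T0} coefYr !coefYl !T1 {T1} /c.
case: n n6 => [|[|[|[|[|[|//]]]]]] _; rewrite /= ?(subSS, subn0) /= ?(E0, E1, E2, E3, E4, E5).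
all: rewrite mx3_0 !(mx3SSl, mx3Sl, mx3Sr, mx3D, mx3N); congr mx3; ring.
Qed.

(** For [z = 0] an antiderivative serves. Otherwise, if [g1] solves the equation for [q'], then
    [(q - g1) / z] solves it for [q]. The size bound is uniform in [z], as the order of an operator
    must be. *)
Lemma solve_const_ode (z : C) n (q : P) : (size q <= n)%N ->
  exists2 g : P, (size g <= n.+1)%N & (z%:M)%:P * g + g^`() = q.
Proof.
have [->|z0] := eqVneq z 0.
  move=> sq; exists (\poly_(i < n.+1) ((i%:R^-1)%:M * q`_i.-1)); first exact: size_poly.
  (* At [i = 0] the convention [0^-1 = 0] makes the constant term zero. *)
  rewrite raddf0 mul0r add0r; apply/polyP => k; rewrite coef_deriv coef_poly ltnS /=.
  case: ltnP => h; last by rewrite mul0rn nth_default // (leq_trans sq).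
  by rewrite -mulmxE mul_scalar_mx scalerMnl -mulr_natl mulfV ?scale1r // pnatr_eq0.
elim: n q => [|n IH] q sq.
  exists 0; first by rewrite size_poly0.
  by rewrite mulr0 raddf0 addr0; apply/esym/eqP; rewrite -size_poly_leq0.
have [|g sg eg] := IH q^`().
  by apply/leq_sizeP => k h; rewrite coef_deriv nth_default ?mul0rn // (leq_trans sq).
exists ((z^-1%:M)%:P * (q - g)).
  apply/leq_sizeP => k h; rewrite coefCM coefB !nth_default ?subr0 ?mulr0 //.
    by apply: leq_trans h; apply: leq_trans sg _.
  by apply: leq_trans h; apply: leq_trans sq _.
have zz : (z%:M)%:P * (z^-1%:M)%:P = 1 :> P.
  by rewrite -polyCM -mulmxE -scalar_mxM mulfV.
have zz' : (z^-1%:M)%:P * (z%:M)%:P = 1 :> P.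
  by rewrite -polyCM -mulmxE -scalar_mxM mulVf.
rewrite deriv_mulC derivB; move: zz zz' eg.
set a := (z%:M)%:P; set a' := (z^-1%:M)%:P; clearbody a a' => aa' a'a eg.
by rewrite mulrA aa' mul1r -eg addrK mulrA a'a mul1r subrK.
Qed.

(** The pointwise verification for [b = theta - X g]: [x] is the value of [X], [k] its inverse,
    primes are derivatives, and the second summand on the left is [b']. *)
Lemma eigen_identity (z k x c m m' g g' : M3) :
  k * x = 1 -> x * k = 1 -> c * x = x * c -> (forall a, z * a = a * z) ->
  z * g + g' = m' * x + m + m ->
  (z - k) * (c + x * m * x - x * g) + (m * x + x * m' * x + x * m - (g + x * g')) =
  (c + x * m * x) * (z - k).
Proof.
move=> kx xk cx zC e.
have ck : k * c = c * k by rewrite -[k * c]mulr1 -xk mulrA -[k * c * x]mulrA cx mulrA kx mul1r.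
have e1 : k * (x * m * x) = m * x by rewrite !mulrA kx mul1r.
have e2 : (x * m * x) * k = x * m by rewrite -mulrA xk mulr1.
have e3 : k * (x * g) = g by rewrite mulrA kx mul1r.
have e4 : x * g' = x * m' * x + x * m + x * m - z * (x * g).
  have -> : g' = m' * x + m + m - z * g by rewrite -e addrC addKr.
  by rewrite !(mulrDr, mulrN) !mulrA zC.
have e5 : k * (c + x * m * x) = c * k + m * x by rewrite mulrDr e1 ck.
have e6 : (c + x * m * x) * k = c * k + x * m by rewrite mulrDl e2.
rewrite [LHS]addrC mulrBl !mulrBr e5 e6 e3 e4 -[(c + x * m * x) * z]zC.
have eD (A B : M3) i j : (A + B) i j = A i j + B i j by rewrite mxE.
have eN (A : M3) i j : (- A) i j = - A i j by rewrite mxE.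
apply/matrixP => i j; rewrite !(eD, eN); ring.
Qed.

End Intermediate.

(** * Equality of Gamma and A *)

Section Equivalence.
Variable R : realType.
Local Notation C := (R[i]).
Local Notation M3 := 'M[C]_3.
Local Notation P := {poly M3}.
Local Notation S := (@Smx R).
Local Notation X := (Xp R).

Lemma invXS_inverse (x : C) : x != 0 ->
  invXS x * (x%:M + S) = 1 /\ (x%:M + S) * invXS x = 1.
Proof.
move=> x0; have x3 : x ^+ 3 != 0 by rewrite expf_neq0.
have eX : X.[x%:M] = x%:M + S by rewrite /Xp hornerD hornerX hornerC.
have e3 : ('X^3 : P).[x%:M] = x ^+ 3 *: 1.
  by rewrite hornerXn -rmorphXn /= -scalemx1.
split; apply: (scalerI x3); rewrite -e3.
  by rewrite scalerAl -Yp_horner // -eX -hornerM_scalar YpXp.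
by rewrite scalerAr -Yp_horner // -eX -hornerM_scalar XpYp.
Qed.

Lemma Spoly_comm (c0 c1 c2 : C) : Spoly c0 c1 c2 * S = S * Spoly c0 c1 c2.
Proof. by rewrite Spoly_mx3 mx3Sl mx3Sr. Qed.

Lemma inXMX_inA (theta : P) : inXMX theta -> inA theta.
Proof.
move=> [c0 [c1 [c2 [m e]]]]; apply/inAP.
pose q : P := m^`() * X + m + m.
have G z : exists g : P, (size g <= (size q).+1)%N /\ (z%:M)%:P * g + g^`() = q.
  by have [g sg eg] := solve_const_ode z (leqnn (size q)); exists g.
have [g Hg] := choice G.
(* The size of [g z] is bounded through [q] alone, which yields an order independent of [z]. *)
exists (maxn (size theta) ((size X + (size q).+1).-1)), (fun z => theta - X * g z).
split=> [z|x z x0].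
  apply: leq_trans (size_polyD _ _) _; rewrite size_polyN geq_max leq_maxl /= leq_max.
  apply/orP; right; apply: leq_trans (size_polyMleq _ _) _.
  by rewrite -!subn1 leq_sub2r // leq_add2l; case: (Hg z).
have [kx xk] := invXS_inverse x0; have [_ eg] := Hg z.
have eX : X.[x%:M] = x%:M + S by rewrite /Xp hornerD hornerX hornerC.
have dX : X^`() = 1 by rewrite /Xp derivD derivX derivC addr0.
have := congr1 (fun p : P => p.[x%:M]) eg.
rewrite e /q derivB derivD derivC add0r !derivM dX !mul1r mulr1 [(m + _) * X]mulrDl.
move: (Spoly_comm c0 c1 c2) eX; move: (Spoly _ _ _) X => c y cS ey.
rewrite !(hornerC, hornerD, hornerN, hornerM_scalar) ey.
apply: eigen_identity => //; last by move=> a; exact: scalar_mx_comm.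
by rewrite mulrDr mulrDl cS scalar_mx_comm.
Qed.

(** The inclusions form a cycle from Gamma through [inXMX] to A and, by elimination, back to
    Gamma. *)
Lemma inGammaE (theta : P) : inGamma theta <-> inA theta.
Proof.
split; first by move=> /Gamma_inXMX /inXMX_inA.
by move=> /Lam_eq0 H; exact: Lam_Gamma.
Qed.

Lemma inAE (theta : P) : inA theta <-> inXMX theta.
Proof. by split; [move=> /inGammaE /Gamma_inXMX | exact: inXMX_inA]. Qed.
End Equivalence.

(** * Normal forms of words *)

Section Words.
Variable R : realType.
Local Notation C := (R[i]).
Local Notation M3 := 'M[C]_3.
Local Notation P := {poly M3}.
Local Notation S := (@Smx R).
Local Notation X := (Xp R).
Local Notation Y := (Yp R).

(* [alpha_2] and [alpha_3]; indices start at 0, so [delta_mx 2 0] is [e_31]. *)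
Definition gen2 : P := S%:P.
Definition gen3 : P := X * (delta_mx 2 0 : M3)%:P * X.

Lemma poly_mx_ext (p q : P) : (forall x : C, x != 0 -> p.[x%:M] = q.[x%:M]) -> p = q.
Proof.
move=> H; apply/eqP; rewrite -subr_eq0; apply/eqP/poly_mx_eq0 => x x0.
by rewrite hornerD hornerN H // subrr.
Qed.

Lemma Xp_horner (x : C) : X.[x%:M] = mx3 x 1 0 0 x 1 0 0 x.
Proof.
rewrite /Xp hornerD hornerX hornerC mx3S -scalemx1 -[1%:M]/(1 : M3) mx3_1 mx3Z mx3D.
by rewrite !(mulr0, mulr1, addr0, add0r).
Qed.

Lemma mx3E20 : (delta_mx 2 0 : M3) = mx3 0 0 0 0 0 0 1 0 0.
Proof.
apply/matrixP => k l; rewrite !mxE.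
by case: k => [[|[|[|//]]] hk]; case: l => [[|[|[|//]]] hl].
Qed.

(** This is the rank-one matrix [u v] with column [u = (0, 1, x)] and row [v = (x, 1, 0)]. From
    [v u = 1], [v S u = 2 x] and [v S^2 u = x^2] come the identities for the generators below. *)
Lemma gen3_horner (x : C) :
  gen3.[x%:M] = mx3 0 0 0 x 1 0 (x * x) x 0.
Proof.
rewrite /gen3; have := Xp_horner x; move: X => y ey.
rewrite !hornerM_scalar hornerC ey mx3E20 !mx3M; congr mx3; ring.
Qed.

Lemma gen2_cube : gen2 * gen2 * gen2 = 0.
Proof. by rewrite /gen2 -!polyCM Smx3. Qed.

Lemma gen3_idem : gen3 * gen3 = gen3.
Proof.
apply: poly_mx_ext => x _; rewrite hornerM_scalar gen3_horner mx3M; congr mx3; ring.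
Qed.

Lemma gen323 : gen3 * gen2 * gen3 = 'X * gen3 + 'X * gen3.
Proof.
apply: poly_mx_ext => x _; move: gen3 (gen3_horner x) => g eg.
rewrite hornerD !hornerM_scalar hornerX /gen2 hornerC eg mx3Sr mx3M.
rewrite -mulmxE mul_scalar_mx mx3Z mx3D; congr mx3; ring.
Qed.

Lemma gen32323 :
  gen3 * gen2 * gen3 * gen2 * gen3 = ((4 : C)%:M)%:P * (gen3 * gen2 * gen2 * gen3).
Proof.
apply: poly_mx_ext => x _; move: gen3 (gen3_horner x) => g eg.
rewrite !hornerM_scalar /gen2 !hornerC eg !mx3Sr !mx3M !mx3Sr !mx3M.
rewrite -mulmxE mul_scalar_mx mx3Z; congr mx3; ring.
Qed.

(** Multiplying by [Y] on both sides gives [Y c Y + x^6 m = 0]. The coefficient of [x^4] is [c],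
    hence [c = 0] and then [m = 0]. *)
Lemma inXMX_unique (c0 c1 c2 : C) (m : P) : (Spoly c0 c1 c2)%:P + X * m * X = 0 ->
  [/\ c0 = 0, c1 = 0, c2 = 0 & m = 0].
Proof.
move=> e; have e6 : Y * (Spoly c0 c1 c2)%:P * Y + 'X^6 * m = 0.
  have := congr1 (fun p => Y * p * Y) e; rewrite mulr0 mul0r (mulrDr Y) (mulrDl _ _ Y) => h.
  rewrite -[RHS]h; congr (_ + _).
  by rewrite !mulrA YpXp -!mulrA XpYp -commXpoly !mulrA.
have Sp0 : Spoly c0 c1 c2 = 0.
  have /polyP /(_ 4%N) := e6; move: (Spoly c0 c1 c2) => c.
  rewrite coefD coefXnM /= coefYr !coefYl !coefC /= !(mulr0, subr0, addr0, mul0r); exact.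
have m0 : m = 0.
  move: e6; rewrite Sp0 mulr0 mul0r add0r => e6.
  by apply: (@polyXn_inj _ 6); rewrite e6 mulr0.
by move: Sp0; rewrite Spoly_mx3 mx3_0 => /eq_mx3 [[-> -> ->] _ _].
Qed.

(* [inl i] stands for [alpha_2^i] and [inr (i, k, j)] for
   [alpha_2^i alpha_3 (alpha_2 alpha_3)^k alpha_2^j]. *)
Definition nform := ('I_3 + 'I_3 * nat * 'I_3)%type.

Definition nword (n : nform) : seq bool :=
  match n with
  | inl i => nseq i false
  | inr (i, k, j) => nseq i false ++ true :: flatten (nseq k [:: false; true]) ++ nseq j false
  end.

Definition weval (w : seq bool) : P := \prod_(c <- w) (if c then gen3 else gen2).

Lemma weval_cat u v : weval (u ++ v) = weval u * weval v.
Proof. by rewrite /weval big_cat. Qed.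

Lemma weval_nseq i : weval (nseq i false) = (S ^+ i)%:P.
Proof.
rewrite polyC_exp; elim: i => [|i IH]; first by rewrite /weval big_nil expr0.
by rewrite exprS -IH /weval big_cons.
Qed.

(** Left multiplication by [S] moves rows up and right multiplication moves columns right, so the
    nine products run through all matrix units. *)
Lemma mxSES (i j : 'I_3) : S ^+ i * delta_mx 2 0 * S ^+ j = delta_mx (rev_ord i) j.
Proof.
rewrite mx3E20; case: i => [[|[|[|//]]] hi]; case: j => [[|[|[|//]]] hj] /=.
all: rewrite ?expr0 ?expr1 ?expr2 ?mul1r ?mulr1 ?mulrA -?[S * S * mx3 _ _ _ _ _ _ _ _ _]mulrA.
all: rewrite ?mx3Sl ?mx3Sl ?mx3Sr ?mx3Sr; apply/matrixP => k l; rewrite !mxE.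
all: by case: k => [[|[|[|//]]] hk]; case: l => [[|[|[|//]]] hl].
Qed.

Lemma X_comm_S i : X * (S ^+ i)%:P = (S ^+ i)%:P * X.
Proof.
rewrite polyC_exp; apply: GRing.commrX; rewrite /Xp.
apply: GRing.commr_sym; apply: GRing.commrD => //.
exact: commr_polyX.
Qed.

Lemma polyC_scalarC (c : C) (p : P) : p * (c%:M)%:P = (c%:M)%:P * p.
Proof. by apply/polyP => k; rewrite coefCM coefMC scalar_mx_comm. Qed.

Lemma scalXn_central (c : C) (k : nat) (p : P) :
  p * ((c%:M)%:P * 'X^k) = (c%:M)%:P * 'X^k * p.
Proof.
by rewrite mulrA polyC_scalarC -[_ * p * _]mulrA -commXpoly mulrA.
Qed.

Lemma weval_nword (n : nform) : weval (nword n) =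
  match n with
  | inl i => (S ^+ i)%:P
  | inr (i, k, j) => X * (((2 ^+ k : C)%:M)%:P * (delta_mx (rev_ord i) j : M3)%:P * 'X^k) * X
  end.
Proof.
case: n => [i|[[i k] j]]; first exact: weval_nseq.
(* By [gen323] each further pair of letters contributes a central factor [2 x]. *)
have e1 : weval (true :: flatten (nseq k [:: false; true])) = ((2 ^+ k : C)%:M)%:P * 'X^k * gen3.
  elim: k => [|k IH]; first by rewrite /weval big_cons big_nil mulr1 expr0 !mul1r.
  rewrite -[nseq k.+1 _]/([:: false; true] :: nseq k _) /=.
  rewrite /weval 2!big_cons -[\prod_(c <- _) _]/(weval _) IH.
  have := gen323; move: gen2 gen3 => g2 g3 e.
  rewrite [g2 * _]mulrA [g3 * _]mulrA [g3 * (g2 * _)]mulrA scalXn_central.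
  rewrite -[_ * (g3 * g2) * g3]mulrA e.
  rewrite -mulrDl mulrA; congr (_ * g3).
  rewrite -[_ * 'X^k * _]mulrA mulrDr -exprSr -mulr2n -['X^_ *+ 2]mulr_natl mulrA.
  congr (_ * 'X^_).
  rewrite exprSr scalar_mxM polyCM; congr (_ * _).
  by rewrite -[RHS]/((scalar_mx 2%:R)%:P) rmorph_nat polyC_natr.
rewrite /nword weval_cat -cat_cons weval_cat !weval_nseq e1 /gen3 -mxSES !polyCM.
move: (X_comm_S i) (X_comm_S j); move: (S ^+ i)%:P (S ^+ j)%:P => si sj.
move: (delta_mx 2 0)%:P X (scalXn_central (2 ^+ k) k) => d x hz hi hj.
have -> : forall p : P, (2 ^+ k)%:M%:P * p * 'X^k = (2 ^+ k)%:M%:P * 'X^k * p.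
  by move=> p; rewrite -[_ * p * _]mulrA -commXpoly mulrA.
move: ((2 ^+ k)%:M%:P * 'X^k) hz => z hz.
rewrite !mulrA (hz si) (hz x) -[z * x * si]mulrA hi !mulrA.
by rewrite -[_ * sj * x]mulrA -hj mulrA.
Qed.

End Words.

(** * The presentation *)

Section Presentation.
Variable R : realType.
Local Notation C := (R[i]).
Local Notation M3 := 'M[C]_3.
Local Notation P := {poly M3}.
Local Notation X := (Xp R).
Local Notation F := (fa R).
Local Notation ev := (fa_eval (gen2 R) (gen3 R)).

(** * Reduction to normal forms modulo the ideal *)

Definition fa_gen (s : seq (F * 'I_3 * F)) : F :=
  flatten [seq fa_mul (fa_mul t.1.1 (rels R t.1.2)) t.2 | t <- s].

(* Equality modulo the ideal. *)
Definition cong (p q : F) : Prop := exists s, fa_eq p (q ++ fa_gen s).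

Definition lmul (c : C) (u : seq bool) (p : F) : F := [seq (c * t.1, u ++ t.2) | t <- p].

Lemma fa_coef_cat (p q : F) w : fa_coef (p ++ q) w = fa_coef p w + fa_coef q w.
Proof. exact: big_cat. Qed.

Lemma fa_gen_cat s1 s2 : fa_gen (s1 ++ s2) = fa_gen s1 ++ fa_gen s2.
Proof. by rewrite /fa_gen map_cat flatten_cat. Qed.

Lemma cong_refl p : cong p p.
Proof. by exists [::] => w; rewrite /fa_gen /= cats0. Qed.

Lemma cong_trans q p r : cong p q -> cong q r -> cong p r.
Proof.
move=> [s1 h1] [s2 h2]; exists (s2 ++ s1) => w.
by rewrite h1 fa_coef_cat h2 fa_gen_cat !fa_coef_cat addrA.
Qed.

Lemma cong_cat p1 p2 q1 q2 : cong p1 q1 -> cong p2 q2 -> cong (p1 ++ p2) (q1 ++ q2).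
Proof.
move=> [s1 h1] [s2 h2]; exists (s1 ++ s2) => w.
by rewrite fa_gen_cat !fa_coef_cat h1 h2 !fa_coef_cat addrACA.
Qed.

Lemma fa_coef_lmul c u p w : fa_coef (lmul c u p) w =
  if take (size u) w == u then c * fa_coef p (drop (size u) w) else 0.
Proof.
rewrite /fa_coef big_map /=; case: ifP => h.
  rewrite mulr_sumr; apply: eq_bigl => t.
  by rewrite -{1}(cat_take_drop (size u) w) (eqP h) eqseq_cat // eqxx [RHS]eq_sym eq_sym.
by rewrite big1 // => t /eqP e; rewrite -e take_size_cat // eqxx in h.
Qed.

Lemma fa_mul_cons a (p q : F) :
  fa_mul (a :: p) q = [seq (a.1 * b.1, a.2 ++ b.2) | b <- q] ++ fa_mul p q.
Proof. by []. Qed.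

Lemma fa_mul_lmul c u (p q : F) : fa_mul (lmul c u p) q = lmul c u (fa_mul p q).
Proof.
elim: p => // a p IH; rewrite [lmul c u (a :: p)]/= !fa_mul_cons IH /lmul map_cat -map_comp.
by congr (_ ++ _); apply: eq_map => b /=; rewrite mulrA catA.
Qed.

Lemma cong_lmul c u p q : cong p q -> cong (lmul c u p) (lmul c u q).
Proof.
move=> [s h]; exists [seq (lmul c u t.1.1, t.1.2, t.2) | t <- s] => w.
have -> : fa_gen [seq (lmul c u t.1.1, t.1.2, t.2) | t <- s] = lmul c u (fa_gen s).
  rewrite /fa_gen /lmul map_flatten -!map_comp; congr flatten; apply: eq_map => t /=.
  by rewrite !fa_mul_lmul.
rewrite -[lmul c u q ++ _]map_cat -/(lmul c u _) !fa_coef_lmul.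
by case: ifP => // _; rewrite h.
Qed.

(** One application of a relation at the start of a word; [cong_lmul] supplies prefixes. *)
Lemma cong_rel (c : C) i w (p q : F) :
  fa_eq p (q ++ fa_mul (fa_mul [:: (c, [::])] (rels R i)) [:: (1, w)]) -> cong p q.
Proof. by move=> h; exists [:: ([:: (c, [::])], i, [:: (1, w)])]; rewrite /fa_gen /= cats0. Qed.

(** Zero is written as an arbitrary word with coefficient 0, so that every word reduces to a
    multiple of some normal form. *)
Lemma cong_rel1 (c c' : C) w w' : c' = 0 ->
  cong [:: (c, [:: false, false, false & w])] [:: (c', w')].
Proof.
move=> ->; apply: (@cong_rel c 0 w) => v; rewrite /fa_coef /= !big_cons !big_nil /=.
by case: eqP => _; case: eqP => _; ring.
Qed.

Lemma cong_rel2 (c : C) w : cong [:: (c, [:: true, true & w])] [:: (c, true :: w)].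
Proof.
apply: (@cong_rel c 1 w) => v; rewrite /fa_coef /= !big_cons !big_nil /=.
by case: eqP => _; case: eqP => _; ring.
Qed.

(** The third relation is oriented towards the longer word, which has no inner square of
    [alpha_2]. *)
Lemma cong_rel3 (c : C) w : cong [:: (c, [:: true, false, false, true & w])]
  [:: (c / 4, [:: true, false, true, false, true & w])].
Proof.
apply: (@cong_rel (- c / 4) 2 w) => v; rewrite /fa_coef /= !big_cons !big_nil /=.
by case: eqP => _; case: eqP => _; field.
Qed.

(** Words are built from the right, and prepending a letter to a normal form calls for at most one
    relation. In the case of [cong_rel3] the exponent [k] grows by 2. *)
Lemma cong_letter (c : C) b (n : nform) :
  exists c' n', cong [:: (c, b :: nword n)] [:: (c', nword n')].
Proof.
case: b; case: n => [i|[[i k] j]].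
- exists c, (inr (ord0, 0%N, i)); exact: cong_refl.
- case: i => [[|[|[|//]]] hi].
  + exists c, (inr (ord0, k, j)); exact: cong_rel2.
  + exists c, (inr (ord0, k.+1, j)); exact: cong_refl.
  + exists (c / 4), (inr (ord0, k.+2, j)); exact: cong_rel3.
- case: i => [[|[|[|//]]] hi].
  + exists c, (inl 1); exact: cong_refl.
  + exists c, (inl 2); exact: cong_refl.
  + exists 0, (inl 0); exact: cong_rel1.
- case: i => [[|[|[|//]]] hi].
  + exists c, (inr (1, k, j)); exact: cong_refl.
  + exists c, (inr (2, k, j)); exact: cong_refl.
  + exists 0, (inl 0); exact: cong_rel1.
Qed.

Lemma cong_word (c : C) w : exists c' n, cong [:: (c, w)] [:: (c', nword n)].
Proof.
elim: w c => [|b w IH] c; first by exists c, (inl 0); exact: cong_refl.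
have [c1 [n1 h1]] := IH c; have [c2 [n2 h2]] := cong_letter c1 b n1.
exists c2, n2; apply: cong_trans h2; have := cong_lmul 1 [:: b] h1.
by rewrite /lmul /= !mul1r.
Qed.

Definition fa_of (p : seq (C * nform)) : F := [seq (t.1, nword t.2) | t <- p].

Lemma cong_nform (p : F) : exists q, cong p (fa_of q).
Proof.
elim: p => [|[c w] p [q IH]]; first by exists [::]; exact: cong_refl.
have [c' [n h]] := cong_word c w; exists ((c', n) :: q); exact: (cong_cat h IH).
Qed.

(** * The evaluation homomorphism *)

Lemma ev_cat (p q : F) : ev (p ++ q) = ev p + ev q.
Proof. exact: big_cat. Qed.

(** Grouping the terms by word shows that evaluation depends only on the coefficients, hence
    respects [fa_eq]. *)
Lemma ev_coef (p : F) (ws : seq (seq bool)) : uniq ws -> {subset [seq t.2 | t <- p] <= ws} ->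
  ev p = \sum_(w <- ws) ((fa_coef p w)%:M)%:P * weval R w.
Proof.
move=> uw sub; rewrite /fa_coef.
under [RHS]eq_bigr => w _ do rewrite !raddf_sum /= mulr_suml.
rewrite (exchange_big_dep predT) //= /fa_eval big_seq [RHS]big_seq; apply: eq_bigr => t tp.
rewrite (eq_bigl (pred1 t.2)); last by move=> w; rewrite /= eq_sym.
by rewrite -[RHS]big_filter filter_pred1_uniq ?sub ?map_f // big_seq1.
Qed.

Lemma ev_eq (p q : F) : fa_eq p q -> ev p = ev q.
Proof.
move=> h; pose ws := undup [seq t.2 | t <- p ++ q].
rewrite (@ev_coef p ws) ?undup_uniq //; last first.
  by move=> w; rewrite mem_undup map_cat mem_cat => ->.
rewrite (@ev_coef q ws) ?undup_uniq //; last first.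
  by move=> w; rewrite mem_undup map_cat mem_cat => ->; rewrite orbT.
by apply: eq_bigr => w _; rewrite h.
Qed.

Lemma ev_cons a (p : F) : ev (a :: p) = ((a.1)%:M)%:P * weval R a.2 + ev p.
Proof. exact: big_cons. Qed.

Lemma ev_mul (p q : F) : ev (fa_mul p q) = ev p * ev q.
Proof.
elim: p => [|a p IH]; first by rewrite /fa_eval /fa_mul /= !big_nil mul0r.
rewrite fa_mul_cons ev_cat IH ev_cons mulrDl; congr (_ + _).
rewrite /fa_eval big_map mulr_sumr; apply: eq_bigr => b _ /=.
rewrite big_cat /= scalar_mxM polyCM -!mulrA; congr (_ * _).
by rewrite !mulrA polyC_scalarC.
Qed.

Lemma ev_rels i : ev (rels R i) = 0.
Proof.
have eN (c : C) (p : P) : ((- c)%:M : M3)%:P * p = - ((c%:M)%:P * p).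
  by rewrite !raddfN mulNr.
have g2 := gen2_cube R; have g3 := gen3_idem R; have g4 := gen32323 R.
rewrite /fa_eval; move: (gen2 R) (gen3 R) g2 g3 g4 => a b g2 g3.
rewrite -!mulrA => g4.
case: i => [[|[|[|//]]] hi]; rewrite /rels /= !big_cons !big_nil /=.
- by rewrite !mulr1 addr0 mul1r mulrA g2.
- by rewrite !mulr1 addr0 mul1r g3 eN mul1r subrr.
- by rewrite !mulr1 addr0 mul1r g4 (eN 4) subrr.
Qed.

Lemma ev_gen s : ev (fa_gen s) = 0.
Proof.
elim: s => [|t s IH]; first by rewrite /fa_eval /fa_gen big_nil.
by rewrite /fa_gen /= ev_cat IH !ev_mul ev_rels mulr0 mul0r addr0.
Qed.

Lemma ev_cong p q : cong p q -> ev p = ev q.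
Proof. by move=> [s /ev_eq ->]; rewrite ev_cat ev_gen addr0. Qed.

(** * Linear independence of the normal forms *)

Definition nform_scalar (p : seq (C * nform)) (i : 'I_3) : C := \sum_(t <- p | t.2 == inl i) t.1.

Definition nform_poly (p : seq (C * nform)) : P :=
  \sum_(t <- p) if t.2 is inr (i, k, j) then
    ((t.1 * 2 ^+ k)%:M)%:P * (delta_mx (rev_ord i) j : M3)%:P * 'X^k else 0.

Lemma ev_fa_of (p : seq (C * nform)) :
  ev (fa_of p) =
  (Spoly (nform_scalar p 0) (nform_scalar p 1) (nform_scalar p 2))%:P + X * nform_poly p * X.
Proof.
elim: p => [|[c n] p IH].
  rewrite /fa_eval big_nil /nform_scalar /nform_poly !big_nil Spoly_mx3 -mx3_0.
  by rewrite mulr0 mul0r addr0 raddf0.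
rewrite [fa_of _]/= ev_cons IH weval_nword /nform_scalar /nform_poly !big_cons /=.
set s0 := \sum_(_ <- _ | _) _; set s1 := \sum_(_ <- _ | _) _; set s2 := \sum_(_ <- _ | _) _.
clearbody s0 s1 s2; case: n => [i|[[i k] j]] /=.
  rewrite add0r addrA; congr (_ + _); rewrite -polyCM -polyCD; congr (_%:P).
  rewrite -mulmxE mul_scalar_mx; case: i => [[|[|[|//]]] hi].
  - rewrite -[RHS]/(Spoly (c + s0) s1 s2) !Spoly_mx3 expr0 mx3_1 mx3Z mx3D.
    by rewrite !(mulr0, mulr1, add0r).
  - rewrite -[RHS]/(Spoly s0 (c + s1) s2) !Spoly_mx3 expr1 mx3S mx3Z mx3D.
    by rewrite !(mulr0, mulr1, add0r).
  - rewrite -[RHS]/(Spoly s0 s1 (c + s2)) !Spoly_mx3 expr2 {1}mx3S mx3Sr mx3Z mx3D.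
    by rewrite !(mulr0, mulr1, add0r).
move: (\sum_(_ <- _) _) => m.
rewrite (mulrDr X) (mulrDl _ _ X) addrCA; congr (_ + (_ + _)).
by rewrite scalar_mxM polyCM !mulrA (polyC_scalarC c X).
Qed.

(** Distinct triples [(i, k, j)] occupy distinct places, so each scalar coefficient isolates one
    normal form, up to the nonzero factor [2^k]. *)
Lemma coef_nform_poly (p : seq (C * nform)) (i j : 'I_3) k :
  (nform_poly p)`_k (rev_ord i) j = 2 ^+ k * \sum_(t <- p | t.2 == inr (i, k, j)) t.1.
Proof.
rewrite /nform_poly; elim: p => [|[c n] p IH]; first by rewrite !big_nil coef0 mxE mulr0.
rewrite !big_cons coefD mxE IH /=; case: n => [i'|[[i' k'] j']] /=.
  by rewrite coef0 mxE add0r.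
rewrite -polyCM coefMXn coefC.
have -> : (inr (i', k', j') == inr (i, k, j) :> nform) = [&& i' == i, k' == k & j' == j].
  by rewrite -[LHS]/((i', k', j') == (i, k, j)) !xpair_eqE andbA.
case: (ltngtP k k') => h /=; rewrite ?(gtn_eqF h) ?(ltn_eqF h) ?andbF ?andFb.
- by rewrite mxE add0r.
- by rewrite subn_eq0 leqNgt h /= mxE add0r.
rewrite h subnn eqxx /= -mulmxE mul_scalar_mx !mxE (inj_eq rev_ord_inj).
rewrite [i == _]eq_sym [j == _]eq_sym; case: (i' == i); case: (j' == j) => /=;
  rewrite ?mulr1 ?mulr0 ?add0r // mulrDr [c * _]mulrC; congr (_ + _).
Qed.

Lemma fa_of_independent (p : seq (C * nform)) : ev (fa_of p) = 0 ->
  forall n, \sum_(t <- p | t.2 == n) t.1 = 0.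
Proof.
rewrite ev_fa_of => /inXMX_unique [n0 n1 n2 m0] [i|[[i k] j]].
  rewrite -/(nform_scalar p i); case: i => [[|[|[|//]]] hi]; [move: n0|move: n1|move: n2].
  - by congr (nform_scalar p _ = 0); apply: val_inj.
  - by congr (nform_scalar p _ = 0); apply: val_inj.
  - by congr (nform_scalar p _ = 0); apply: val_inj.
have := coef_nform_poly p i j k; rewrite m0 coef0 mxE => /esym/eqP.
by rewrite mulf_eq0 expf_eq0 pnatr_eq0 andbF => /eqP.
Qed.

(** Independence replaces a combinatorial argument: two normal forms with the same word would have a
    difference that evaluates to 0. *)
Lemma nword_inj : injective nword.
Proof.
move=> n n' e; apply/eqP/negP => /negP nn.
have := @fa_of_independent [:: (1, n); (-1, n')].
have -> : ev (fa_of [:: (1, n); (-1, n')]) = 0.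
  rewrite (@ev_eq _ [::]) /fa_eval ?big_nil // => w.
  by rewrite /fa_coef /fa_of !big_cons !big_nil /= e; case: (_ == w); rewrite ?addr0 ?subrr.
move=> /(_ erefl n); rewrite !big_cons big_nil /= eqxx [n' == n]eq_sym (negPf nn) addr0.
by move/eqP; rewrite oner_eq0.
Qed.

Lemma fa_of_eq0 (p : seq (C * nform)) : ev (fa_of p) = 0 -> fa_eq (fa_of p) [::].
Proof.
move=> /fa_of_independent h w; rewrite /fa_coef big_nil big_map /=.
have [[n ->]|hw] := pselect (exists n, w = nword n).
  by rewrite -[RHS](h n); apply: eq_bigl => t; rewrite (inj_eq nword_inj).
by apply: big1 => t /eqP e; case: hw; exists t.2.
Qed.

(** Modulo the ideal [p] is a combination of normal forms. If it evaluates to 0, that combination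
    vanishes by independence, leaving [p] in the ideal. *)
Lemma ev_eq0 (p : F) : ev p = 0 <-> inI p.
Proof.
split=> [p0|[s /ev_eq ->]]; last exact: ev_gen.
have [q pq] := cong_nform p; have q0 : ev (fa_of q) = 0 by rewrite -(ev_cong pq).
have [s h] := pq; exists s => w; rewrite h fa_coef_cat (fa_of_eq0 q0).
by rewrite {1}/fa_coef big_nil add0r.
Qed.

Lemma inXMX_ev (theta : P) : inXMX theta <-> exists p : F, theta = ev p.
Proof.
split=> [[c0 [c1 [c2 [m ->]]]]|[p ->]]; last first.
  have [q /ev_cong ->] := cong_nform p; rewrite ev_fa_of.
  by exists (nform_scalar q 0), (nform_scalar q 1), (nform_scalar q 2), (nform_poly q).
have [q1 ->] : exists q, (Spoly c0 c1 c2)%:P = ev q.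
  exists (fa_of [:: (c0, inl 0); (c1, inl 1); (c2, inl 2)]).
  by rewrite ev_fa_of /nform_poly /nform_scalar !big_cons !big_nil /= !addr0 mulr0 mul0r addr0.
suff [q2 ->] : exists q, X * m * X = ev q by exists (q1 ++ q2); rewrite ev_cat.
have Ek k (i j : 'I_3) (c : C) : exists q, X * ((c *: delta_mx i j)%:P * 'X^k) * X = ev q.
  (* [rev_ord] and division by [2^k] invert the formula of [weval_nword]. *)
  exists (fa_of [:: (c / 2 ^+ k, inr (rev_ord i, k, j))]).
  rewrite ev_fa_of /nform_poly /nform_scalar !big_cons !big_nil /= Spoly_mx3 -mx3_0.
  by rewrite add0r addr0 rev_ordK divfK ?expf_neq0 ?pnatr_eq0 // -polyCM -mulmxE mul_scalar_mx.
have sumE (I : Type) (r : seq I) (f : I -> P) :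
    (forall i, exists q, X * f i * X = ev q) -> exists q, X * (\sum_(i <- r) f i) * X = ev q.
  move=> H; elim: r => [|i r [q IH]].
    by exists [::]; rewrite big_nil mulr0 mul0r /fa_eval big_nil.
  have [q' h] := H i; exists (q' ++ q).
  by rewrite big_cons (mulrDr X) (mulrDl _ _ X) h IH ev_cat.
rewrite -[m]coefK poly_def; apply: (sumE) => k.
have -> : m`_k *: 'X^k = \sum_i \sum_j ((m`_k i j *: delta_mx i j)%:P * 'X^k) :> P.
  rewrite -mul_polyC {1}(matrix_sum_delta m`_k) raddf_sum mulr_suml; apply: eq_bigr => i _.
  by rewrite raddf_sum mulr_suml.
apply: (sumE) => i; apply: (sumE) => j; exact: Ek.
Qed.

End Presentation.

Unset Implicit Arguments.

(** The presentation is expressed through the first isomorphism theorem: evaluation at the two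
    generators has image A and kernel I. *)
Theorem theorem2 (R : realType) :
  (forall theta : {poly 'M[R[i]]_3}, inGamma theta <-> inA theta) /\
  (exists a2 a3 : {poly 'M[R[i]]_3},
     (forall theta : {poly 'M[R[i]]_3},
        inA theta <-> exists p : fa R, theta = fa_eval a2 a3 p) /\
     (forall p : fa R, fa_eval a2 a3 p = 0 <-> inI p)).
Proof.
split; first exact: inGammaE.
exists (gen2 R), (gen3 R); split=> [theta|p]; last exact: ev_eq0.
by rewrite inAE; exact: inXMX_ev.
Qed.
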